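(* Let $(T_n)_{n\ge 0}$ be the Tribonacci sequence. The Diophantine equation $$(T_{n}-1)\cdots (T_{n+k-1}-1)\,(T_{n+k}+1) \cdots (T_{n+k+\ell-1}+1)=d\left(\frac{10^{m}-1}{9}\right)$$ has no solution in positive integers $n,k,\ell,m,d$ with $1\leq d\leq 9$ and $m\geq 2$.
   Context: The Tribonacci sequence is defined by $T_0=0$, $T_1=T_2=1$ and $T_{n+3}=T_{n+2}+T_{n+1}+T_n$ for all $n\ge 0$. The right-hand side $d(10^m-1)/9$ is the repdigit consisting of $m$ copies of the digit $d$. *)

(* Defs.v *)
From mathcomp Require Import all_boot all_order all_algebra.

Set Implicit Arguments.
Unset Strict Implicit.
Unset Printing Implicit Defensive.

Fixpoint tribonacci (n : nat) : nat :=
  match n with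
  | 0 => 0
  | 1 => 1
  | 2 => 1
  | ((p.+1 as q).+1 as r).+1 => tribonacci r + tribonacci q + tribonacci p
  end.

(* Main.v *)
Require Import Defs.
From mathcomp Require Import all_boot all_order all_algebra.
From mathcomp Require Import zify.

(** A repdigit [d * 11...1] with [m >= 2] digits is nonzero modulo 16.  Among
    eight consecutive Tribonacci numbers four are odd, so eight or more factors
    [T_i - 1], [T_i + 1] make the product divisible by 16; this leaves finitely
    many pairs [(k, l)].  For those, the equation has no solution locally:
    modulo 32 (period 64 in [n]) only few classes of [n] survive, and these are
    eliminated by successively lifting [(n, m)] to classes modulo larger periods
    and comparing both sides modulo 7, 17, 257, 13, 127 and 421.  Modulus 32 is
    what excludes the degenerate solutions with [m = 0] and [m = 1], which
    satisfy every congruence modulo integers prime to 10. *)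

Lemma iter_modn (S : Type) (f : S -> S) (x : S) (N n : nat) :
  iter N f x = x -> iter n f x = iter (n %% N) f x.
Proof.
move=> fN; rewrite {1}(divn_eq n N) addnC iterD; congr (iter _ _ _).
by elim: (n %/ N) => [|q IHq] //; rewrite mulSn iterD IHq.
Qed.

(** A class modulo [A] splits into [q] classes modulo [A * q]; the one containing [n] is picked by
    the next mixed-radix digit [(n %/ A) %% q]. *)
Lemma modn_lift (A q n : nat) : 0 < A -> 0 < q ->
  exists2 i, i < q & n %% A + A * i = n %% (A * q).
Proof.
move=> A_gt0 q_gt0; exists ((n %/ A) %% q); first by rewrite ltn_mod.
have lt : n %% A + A * ((n %/ A) %% q) < A * q.
  apply: (@leq_trans (A * ((n %/ A) %% q).+1)).
    by rewrite mulnS ltn_add2r ltn_mod.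
  by rewrite leq_mul2l ltn_mod q_gt0 orbT.
rewrite -{1}(modn_small lt) -(modnMDl (n %/ A %/ q)); congr (_ %% _).
by rewrite {4}(divn_eq n A) {3}(divn_eq (n %/ A) q); lia.
Qed.

Lemma tribonacciSSS (n : nat) :
  tribonacci n.+3 = tribonacci n.+2 + tribonacci n.+1 + tribonacci n.
Proof. by []. Qed.

Lemma tribonacci_gt0 (n : nat) : 0 < n -> 0 < tribonacci n.
Proof.
case: n => // n _.
suff: [/\ 0 < tribonacci n.+1, 0 < tribonacci n.+2 & 0 < tribonacci n.+3] by case.
elim: n => [|n [T1 T2 T3]] //; split=> //.
by rewrite tribonacciSSS -addnA ltn_addr.
Qed.

Fixpoint repunit (m : nat) : nat := if m is m'.+1 then 10 * repunit m' + 1 else 0.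

Lemma repunitE (m : nat) : 9 * repunit m + 1 = 10 ^ m.
Proof. by elim: m => // m IHm; rewrite expnS -IHm /=; lia. Qed.

Lemma repunit_mod32 (m : nat) : 1 < m -> repunit m %% 32 \in [:: 11; 15; 23; 7].
Proof.
case: m => [|[|m]] // _; case: m => [|[|[|m]]] //.
(* From five digits on the residue stays 7, which is fixed by [r -> 10 * r + 1] modulo 32. *)
suff -> : repunit m.+4.+1 %% 32 = 7 by [].
by elim: m => // m IHm; move: IHm; rewrite [repunit m.+4.+2]/=; lia.
Qed.

(** The repunit is odd, so 16 would have to divide the digit [d]. *)
Lemma repdigit_mod16 (d m : nat) : 1 < m -> 1 <= d <= 9 -> ~~ (16 %| d * repunit m).
Proof.
move=> /repunit_mod32; rewrite !inE => Rm d19.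
have : odd (repunit m) by lia.
rewrite -coprime2n => /(coprimeXl 4) cop; rewrite Gauss_dvdl // gtnNdvd //; lia.
Qed.

Definition trib_step (p : nat) (s : nat * nat * nat) : nat * nat * nat :=
  let: (x, y, z) := s in (y, z, (x + y + z) %% p).

Definition trib_table (p N : nat) : seq nat :=
  [seq s.1.1 | s <- traject (trib_step p) (0, 1, 1) N].

Definition repunit_step (p r : nat) : nat := (10 * r + 1) %% p.

Definition repunit_table (p o : nat) : seq nat := traject (repunit_step p) 0 o.

(** Both sequences are orbits of a step map, so a single return to the initial state certifies a
    period, minimal or not. *)
Definition periods (p N o : nat) : bool :=
  [&& 1 < p, 0 < N, 0 < o,
      iter N (trib_step p) (0, 1, 1) == (0, 1, 1) & iter o (repunit_step p) 0 == 0].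

Lemma iter_trib_step (p n : nat) : 1 < p ->
  iter n (trib_step p) (0, 1, 1) =
  (tribonacci n %% p, tribonacci n.+1 %% p, tribonacci n.+2 %% p).
Proof.
move=> p_gt1; elim: n => [|n IHn]; first by rewrite /= mod0n modn_small.
rewrite iterS IHn /trib_step; congr (_, _, _).
rewrite modnDmr -addnA modnDml addnCA modnDml tribonacciSSS.
by congr (_ %% _); lia.
Qed.

Lemma iter_repunit_step (p m : nat) : iter m (repunit_step p) 0 = repunit m %[mod p].
Proof.
elim: m => // m IHm; rewrite iterS /repunit_step modn_mod /= -modnDml -modnMmr IHm.
by rewrite modnMmr modnDml.
Qed.

Lemma nth_trib_table (p N n : nat) : 1 < p -> 0 < N ->
  iter N (trib_step p) (0, 1, 1) = (0, 1, 1) ->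
  nth 0 (trib_table p N) (n %% N) = tribonacci n %% p.
Proof.
move=> p_gt1 N_gt0 trN; have ltN : n %% N < N by rewrite ltn_mod.
rewrite (nth_map (0, 1, 1)) ?size_traject // nth_traject //.
by rewrite -iter_modn // iter_trib_step.
Qed.

Lemma nth_repunit_table (p o m : nat) : 0 < o -> iter o (repunit_step p) 0 = 0 ->
  nth 0 (repunit_table p o) (m %% o) = repunit m %[mod p].
Proof.
move=> o_gt0 ro; have lto : m %% o < o by rewrite ltn_mod.
by rewrite nth_traject // -iter_modn // iter_repunit_step.
Qed.

(** For [0 < n] the Tribonacci number is positive, so the truncated predecessor is a genuine
    subtraction. *)
Definition factor (n k i : nat) : nat :=
  if i < k then (tribonacci (n + i)).-1 else (tribonacci (n + i)).+1.

(* Subtracting 1 is encoded as adding [p.-1]. *)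
Definition prod_mod (p N : nat) (t : seq nat) (n k : nat) (s : seq nat) : nat :=
  foldr (fun i v => (nth 0 t ((n + i) %% N) + (if i < k then p.-1 else 1)) %% p * v %% p)
        1 s.

Lemma prod_modE (p N n k : nat) (s : seq nat) : 0 < n -> 1 < p -> 0 < N ->
  iter N (trib_step p) (0, 1, 1) = (0, 1, 1) ->
  prod_mod p N (trib_table p N) n k s = \prod_(i <- s) factor n k i %[mod p].
Proof.
move=> n_gt0 p_gt1 N_gt0 trN; elim: s => [|i s IHs]; first by rewrite big_nil.
rewrite big_cons [prod_mod _ _ _ _ _ _]/= modn_mod -modnMmr IHs modnMmr.
rewrite nth_trib_table // modnDml modnMml -[RHS]modnMml -[LHS]modnMml.
congr (_ * _ %% _); rewrite /factor; case: ifP => _; last by rewrite addn1.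
have := tribonacci_gt0 _ (ltn_addr i n_gt0); case: (tribonacci _) => // x _.
by case: p p_gt1 {trN IHs} => // p _; rewrite /= addSnnS modnDr.
Qed.

Lemma prod_mod_modn (p N A n k : nat) (t s : seq nat) : N %| A ->
  prod_mod p N t (n %% A) k s = prod_mod p N t n k s.
Proof.
by move=> dvN; elim: s => //= i s ->; rewrite -(modnDml (n %% A)) modn_dvdm // modnDml.
Qed.

(* An entry [(p, N, o, q, r)] lifts classes of [(n, m)] modulo [(A, B)] to
   classes modulo [(A * q, B * r)], which determine [tribonacci n] and
   [repunit m] modulo [p] through their periods [N] and [o]. *)
Fixpoint compatible (s : seq (nat * nat * nat * nat * nat)) (A B : nat) : bool :=
  if s is (p, N, o, q, r) :: s' then
    [&& periods p N o, 0 < q, 0 < r, N %| A * q, o %| B * r &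
        compatible s' (A * q) (B * r)]
  else true.

(** Depth-first search over refinements of the class of [(a, b)] modulo [(A, B)]. A branch closes
    when the two sides differ modulo [p]; [false] at the end of the list signals a class that
    survived every modulus. *)
Fixpoint sieve (k l d : nat) (s : seq (nat * nat * nat * nat * nat))
    (A B a b : nat) : bool :=
  if s is (p, N, o, q, r) :: s' then
    let t := trib_table p N in
    let u := repunit_table p o in
    all (fun i =>
      let a' := a + A * i in
      let v := prod_mod p N t a' k (iota 0 (k + l)) %% p in
      all (fun j =>
        let b' := b + B * j in
        if v == d * nth 0 u (b' %% o) %% p
        then sieve k l d s' (A * q) (B * r) a' b' else true) (iota 0 r)) (iota 0 q)
  else false.

(** A solution [(n, m)] would single out one branch at each level, and equality of the two sides
    would keep that branch open down to the final [false]. *)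
Lemma sieveP (k l d : nat) (s : seq (nat * nat * nat * nat * nat)) (A B n m : nat) :
  0 < n -> 0 < A -> 0 < B -> compatible s A B ->
  sieve k l d s A B (n %% A) (m %% B) ->
  \prod_(i <- iota 0 (k + l)) factor n k i <> d * repunit m.
Proof.
move=> n_gt0; elim: s A B => [|[[[[p N] o] q] r] s IHs] A B //= A_gt0 B_gt0.
case/and5P=> /and5P[p_gt1 N_gt0 o_gt0 /eqP trN /eqP ro] q_gt0 r_gt0 dvN.
case/andP=> dvo comp_s /allP sv eq_nm.
have [i lt_iq eq_i] := modn_lift _ _ n A_gt0 q_gt0.
have [j lt_jr eq_j] := modn_lift _ _ m B_gt0 r_gt0.
move: sv => /(_ i); rewrite mem_iota => /(_ lt_iq) /allP/(_ j).
rewrite mem_iota => /(_ lt_jr); rewrite eq_i eq_j prod_mod_modn // prod_modE //.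
rewrite modn_dvdm // eq_nm -(modnMmr d (nth _ _ _)) nth_repunit_table // modnMmr eqxx.
by move/IHs; apply; rewrite ?muln_gt0 ?A_gt0 ?B_gt0.
Qed.

(** Repunits modulo 32 never return to 0, so this modulus cannot be a [sieve] entry: it filters [n]
    modulo 64 against the four possible residues, and [m] starts from the trivial class 0 modulo
    1. *)
Definition sieve_all (s : seq (nat * nat * nat * nat * nat)) : bool :=
  let t := trib_table 32 64 in
  all (fun k => all (fun l => all (fun a =>
    let v := prod_mod 32 64 t a k (iota 0 (k + l)) %% 32 in
    all (fun d =>
      if v \in [seq d * r %% 32 | r <- [:: 11; 15; 23; 7]]
      then sieve k l d s 64 1 a 0 else true)
  (iota 1 9)) (iota 0 64)) (iota 1 (7 - k))) (iota 1 6).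

Lemma sieve_allP (s : seq (nat * nat * nat * nat * nat)) (n k l m d : nat) :
  compatible s 64 1 -> sieve_all s ->
  0 < n -> 0 < k -> 0 < l -> k + l < 8 -> 1 < m -> 1 <= d <= 9 ->
  \prod_(i <- iota 0 (k + l)) factor n k i <> d * repunit m.
Proof.
move=> comp_s /allP/(_ k) sv n_gt0 k_gt0 l_gt0 lt_kl m_gt1 d19 eq_nm.
move: sv; rewrite mem_iota => /(_ ltac:(lia)).
move=> /allP/(_ l); rewrite mem_iota => /(_ ltac:(lia)).
move=> /allP/(_ (n %% 64)); rewrite mem_iota ltn_mod => /(_ isT).
move=> /allP/(_ d); rewrite mem_iota => /(_ ltac:(lia)).
have tr32 : iter 64 (trib_step 32) (0, 1, 1) = (0, 1, 1) by vm_compute.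
rewrite (prod_mod_modn _ _ _ _ _ _ _ (dvdnn 64)).
rewrite (prod_modE 32 64 _ _ _ n_gt0 isT isT tr32).
rewrite eq_nm -(modnMmr d (repunit m)).
rewrite (map_f (fun r => d * r %% 32) (repunit_mod32 _ m_gt1)).
move=> sv; apply: (sieveP k l d s 64 1 n m n_gt0 isT isT comp_s _ eq_nm).
by rewrite modn1.
Qed.

(** Primes whose two periods divide 26880 = 2^8 * 3 * 5 * 7, the final modulus for both [n] and [m];
    this smoothness keeps the branching small. *)
Definition sieve_steps : seq (nat * nat * nat * nat * nat) :=
  [:: (7, 48, 6, 3, 6); (17, 96, 16, 1, 8); (257, 256, 256, 4, 16);
      (13, 168, 6, 7, 1); (127, 5376, 42, 1, 7); (421, 420, 140, 5, 5)].

Lemma compatible_sieve_steps : compatible sieve_steps 64 1.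
Proof. by vm_compute. Qed.

Lemma sieve_all_steps : sieve_all sieve_steps.
Proof. by vm_compute. Qed.

Definition eight_factors_all : bool :=
  let t := trib_table 16 32 in
  all (fun k => all (fun a => prod_mod 16 32 t a k (iota 0 8) %% 16 == 0) (iota 0 32))
      (iota 0 9).

Lemma eight_factors_all_true : eight_factors_all.
Proof. by vm_compute. Qed.

Lemma prod_eight_factors (n k : nat) :
  0 < n -> 16 %| \prod_(i <- iota 0 8) factor n k i.
Proof.
move=> n_gt0.
(* Only the signs of the first eight factors matter, so capping [k] at 8 leaves nine sign patterns
   to check over one period modulo 16. *)
have -> : \prod_(i <- iota 0 8) factor n k i =
          \prod_(i <- iota 0 8) factor n (minn k 8) i.
  rewrite !big_seq; apply: eq_bigr => i; rewrite mem_iota => /andP[_ lt_i8].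
  by rewrite /factor leq_min lt_i8 andbT.
have /allP/(_ (minn k 8)) := eight_factors_all_true.
rewrite mem_iota => /(_ ltac:(lia)) /allP/(_ (n %% 32)).
by rewrite mem_iota ltn_mod => /(_ isT); rewrite prod_mod_modn // prod_modE.
Qed.

Lemma prod_factors (n k l m d : nat) :
  0 < n -> 0 < k -> 0 < l -> 1 < m -> 1 <= d <= 9 ->
  \prod_(i <- iota 0 (k + l)) factor n k i <> d * repunit m.
Proof.
move=> n_gt0 k_gt0 l_gt0 m_gt1 d19; have [|le8] := ltnP (k + l) 8.
  by move=> lt_kl; apply: sieve_allP compatible_sieve_steps sieve_all_steps _ _ _ _ _ _.
move=> eq_nm; have /negP[] := repdigit_mod16 _ _ m_gt1 d19.
rewrite -eq_nm -(subnKC le8) iotaD big_cat dvdn_mulr //.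
exact: prod_eight_factors.
Qed.

Import GRing.Theory Num.Theory.

Local Open Scope ring_scope.

Lemma prod_factorsE (R : comNzRingType) (n k l : nat) : (0 < n)%N ->
  (\prod_(n <= i < n + k) ((tribonacci i)%:R - 1)) *
    (\prod_(n + k <= i < n + k + l) ((tribonacci i)%:R + 1))
  = (\prod_(i <- iota 0 (k + l)) factor n k i)%N%:R :> R.
Proof.
move=> n_gt0; rewrite iotaD add0n big_cat natrM !natr_prod; congr (_ * _).
  rewrite /index_iota addKn -[in iota n k](addn0 n) iotaDl big_map.
  rewrite !big_seq; apply: eq_bigr => i; rewrite mem_iota => /andP[_ lt_ik].
  have := tribonacci_gt0 _ (ltn_addr i n_gt0).
  by rewrite /factor lt_ik; case: (tribonacci _) => // x _; rewrite -natr1 addrK.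
rewrite /index_iota addKn iotaDl big_map !big_seq; apply: eq_bigr => i.
by rewrite mem_iota => /andP[le_ki _]; rewrite /factor ltnNge le_ki -natr1.
Qed.

Theorem theorem3 (n k l m d : nat) :
  (0 < n)%N -> (0 < k)%N -> (0 < l)%N -> (2 <= m)%N -> (1 <= d <= 9)%N ->
  (\prod_(n <= i < n + k) ((tribonacci i)%:R - 1)) *
    (\prod_(n + k <= i < n + k + l) ((tribonacci i)%:R + 1))
  <> d%:R * ((10 ^+ m - 1) / 9) :> rat.
Proof.
move=> n_gt0 k_gt0 l_gt0 m_ge2 d19; rewrite prod_factorsE //.
have -> : (10 ^+ m - 1) / 9 = (repunit m)%:R :> rat.
  by rewrite -natrX -repunitE natrD addrK natrM mulrC mulKf.
rewrite -natrM => /eqP; rewrite eqr_nat => /eqP.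
exact: prod_factors.
Qed.
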